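(* Consider the system describing the expected estimation error of the overall network, $$\mathbb{E}_{\phi}\mathbb{E}_{v}\,\mathbf{e}(t)=\mathbb{E}_{\phi}\big(\mathbf{K}(t)\circ\Phi(t)\big)\,\mathbb{E}_{\phi}\mathbb{E}_{v}\,\mathbf{e}(t-1)-\delta(t)\,\mathbb{E}_{\phi}\big(\mathbf{K}(t)\circ\Phi(t)\big)\mathbf{1},$$ and assume that (i) $\gamma(\mathbf{K}(t)\circ\varphi_{|t})\le\gamma_{\max}<1$ for all $t\in\mathbb{N}_0$ and for each and every packet loss realization $\varphi_{|t}$ of $\Phi(t)$; (ii) $|\delta(t)|<\Delta$ for all $t\in\mathbb{N}_0$. Then, considering independent packet losses, $$\lim_{t\to+\infty}\|\mathbb{E}_{\phi}\mathbb{E}_{v}\,\mathbf{e}(t)\|\le\frac{\Delta\sqrt{N}\,\gamma_{\max}}{1-\gamma_{\max}}.$$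
   Context: A network of $N>1$ sensor nodes tracks a scalar signal $d(t)$, $t\in\mathbb{N}_0=\mathbb{N}\cup\{0\}$. Node $i$ measures $u_i(t)=d(t)+v_i(t)$, where the noises $v_i(t)$ are normal with zero mean and variance $\sigma^2$, uncorrelated across nodes. Node $i$ computes the estimate $x_i(t)=\sum_{j=1}^N k_{ij}(t)\phi_{ij}(t)x_j(t-1)+\sum_{j=1}^N h_{ij}(t)\phi_{ij}(t)u_j(t)$, with $x_i(0)=u_i(0)$. Here $\phi_{ij}(t)\in\{0,1\}$ equals 1 iff node $i$ receives the packet of node $j$ at time $t$; for $i\ne j$ these are independent Bernoulli variables, independent among links and of past packet losses, and $\phi_{ii}(t)=1$. The weights satisfy $\sum_j k_{ij}(t)\phi_{ij}(t)+\sum_j h_{ij}(t)\phi_{ij}(t)=1$ for every $i$ and every packet loss realization. $\mathbf{K}(t)=[k_{ij}(t)]$ and $\Phi(t)=[\phi_{ij}(t)]$ are $N\times N$ matrices, and $\varphi_{|t}$ denotes a realization of $\Phi(t)$. The estimation error is $\mathbf{e}(t)=(e_1(t),\dots,e_N(t))^T$ with $e_i(t)=x_i(t)-d(t)$, and $\delta(t)=d(t)-d(t-1)$. $\mathbb{E}_\phi$ and $\mathbb{E}_v$ are expectations with respect to the packet losses and the measurement noise; $\gamma_{\max}$ and $\Delta$ are constants; $\circ$ is the Hadamard (entrywise) product, $\gamma(\cdot)$ the largest singular value, $\|\cdot\|$ the Euclidean norm, and $\mathbf{1}=(1,\dots,1)^T$.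
   Formalization: The limit of the norm of the expected error need not exist (for instance when the signal alternates between long constant and long increasing stretches), so the bound is proved for the limit superior, which equals the limit whenever the limit exists. *)

(* Defs.v *)
From HB Require Import structures.
From mathcomp Require Import all_boot all_order all_algebra.
From mathcomp Require Import all_classical all_reals all_analysis.

Set Implicit Arguments.
Unset Strict Implicit.
Unset Printing Implicit Defensive.

Import Order.TTheory GRing.Theory Num.Theory.
Local Open Scope classical_set_scope.
Local Open Scope ring_scope.

Definition hadamard (R : realType) (m n : nat) (A B : 'M[R]_(m, n)) :
  'M[R]_(m, n) := map2_mx *%R A B.

(* The library norm on matrices is the sup norm, hence this definition. *)
Definition euclidean_norm (R : realType) (n : nat) (x : 'cV[R]_n) : R :=
  Num.sqrt (\sum_(i < n) x i 0 ^+ 2).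

Definition singular_value (R : realType) (n : nat) (A : 'M[R]_n) (s : R) :
  Prop := 0 <= s /\ eigenvalue (A^T *m A) (s ^+ 2).

(* For n > 0 the set below is finite and nonempty, so this supremum is a
   maximum. *)
Definition largest_singular_value (R : realType) (n : nat) (A : 'M[R]_n) : R :=
  sup [set s | singular_value A s].

Definition expectation_mx (d : measure_display) (T : measurableType d)
    (R : realType) (P : probability T R) (m n : nat) (X : T -> 'M[R]_(m, n)) :
  'M[R]_(m, n) := \matrix_(i, j) fine ('E_P[fun w => X w i j])%E.

Definition mutually_independent (d d' : measure_display)
    (T : measurableType d) (U : measurableType d') (R : realType)
    (P : probability T R) (I : eqType) (D : set I) (X : I -> T -> U) : Prop :=
  forall (s : seq I) (B : I -> set U), uniq s -> (forall i, i \in s -> D i) ->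
    (forall i, measurable (B i)) ->
    P (\bigcap_(i in [set` s]) (X i @^-1` B i)) =
    (\prod_(i <- s) P (X i @^-1` B i))%E.

Section sensor_network.
Context (R : realType) (N : nat).
(* T is the sample space of the packet losses, T' that of the noise. *)
Context (T T' : Type).
Variables (d : nat -> R) (v : nat -> 'I_N -> T' -> R).
Variables (phi : nat -> 'I_N -> 'I_N -> T -> bool).
(* The weights may depend on the realization of the packet losses. *)
Variables (K H : nat -> T -> 'M[R]_N).

(* Since 0.-1 = 0, this gives delta 0 = 0, standing for the undefined
   d(0) - d(-1); a strict bound |delta t| < Delta at t = 0 then already follows
   from the same bound at t = 1. *)
Definition delta (t : nat) : R := d t - d t.-1.

Definition packet_mx (t : nat) (w : T) : 'M[R]_N :=
  \matrix_(i, j) (phi t i j w)%:R.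

Definition measurement (t : nat) (w' : T') : 'cV[R]_N :=
  \col_i (d t + v t i w').

Fixpoint estimate (t : nat) (w : T) (w' : T') : 'cV[R]_N :=
  if t is s.+1 then
    \col_i (\sum_j K t w i j * packet_mx t w i j * estimate s w w' j 0 +
            \sum_j H t w i j * packet_mx t w i j * measurement t w' j 0)
  else measurement 0 w'.

Definition error (t : nat) (w : T) (w' : T') : 'cV[R]_N :=
  \col_i (estimate t w w' i 0 - d t).

End sensor_network.

Definition expected_error (R : realType) (N : nat) (d1 d2 : measure_display)
    (T : measurableType d1) (T' : measurableType d2)
    (Pphi : probability T R) (Pv : probability T' R)
    (d : nat -> R) (v : nat -> 'I_N -> T' -> R)
    (phi : nat -> 'I_N -> 'I_N -> T -> bool) (K H : nat -> T -> 'M[R]_N)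
    (t : nat) : 'cV[R]_N :=
  expectation_mx Pphi (fun w =>
    expectation_mx Pv (fun w' => error d v phi K H t w w')).

(* Main.v *)
(* With [M t = E(K t o Phi t)] and [e] the expected error, the system reads
   [e t = M t (e (t-1) - delta t 1)].  The spectral bound passes to the mean,
   [|M t x| <= gamma_max |x|], because [y^T M t x] is the mean of
   [y^T (K t o Phi t) x <= |y| gamma_max |x|].  Hence
   [|e t| <= gamma_max |e (t-1)| + gamma_max Delta sqrt N], an affine contraction
   whose fixed point is the claimed bound. *)

Require Import Defs.
From HB Require Import structures.
From mathcomp Require Import all_boot all_order all_algebra.
From mathcomp Require Import all_classical all_reals all_analysis.
From mathcomp Require Import measurable_realfun ring lra.

Set Implicit Arguments.
Unset Strict Implicit.
Unset Printing Implicit Defensive.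

Import Order.TTheory GRing.Theory Num.Theory.
Local Open Scope classical_set_scope.
Local Open Scope ring_scope.

(** * Bilinear forms and the Euclidean inner product *)

(** The inner product is the case [B = 1%:M], so a single Cauchy-Schwarz inequality for semidefinite
    forms serves both it and general matrices. *)
Definition bilin (R : realType) (m n : nat) (B : 'M[R]_(m, n))
  (x : 'cV[R]_m) (y : 'cV[R]_n) : R := (x^T *m B *m y) 0 0.

Lemma bilinE (R : realType) (m n : nat) (B : 'M[R]_(m, n)) x y :
  bilin B x y = \sum_i \sum_j x i 0 * B i j * y j 0.
Proof.
rewrite /bilin mxE exchange_big /=; apply: eq_bigr => j _.
by rewrite mxE mulr_suml; apply: eq_bigr => i _; rewrite mxE.
Qed.

Lemma bilin_tr (R : realType) (m n : nat) (B : 'M[R]_(m, n)) x y :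
  bilin B^T x y = bilin B y x.
Proof.
rewrite /bilin; have -> : y^T *m B *m x = (x^T *m B^T *m y)^T.
  by rewrite !trmx_mul !trmxK mulmxA.
by rewrite [RHS]mxE.
Qed.

Lemma bilinDl (R : realType) (m n : nat) (B : 'M[R]_(m, n)) x y z :
  bilin B (x + y) z = bilin B x z + bilin B y z.
Proof. by rewrite /bilin linearD /= !mulmxDl mxE. Qed.

Lemma bilinDr (R : realType) (m n : nat) (B : 'M[R]_(m, n)) x y z :
  bilin B x (y + z) = bilin B x y + bilin B x z.
Proof. by rewrite /bilin mulmxDr mxE. Qed.

Lemma bilinZl (R : realType) (m n : nat) (B : 'M[R]_(m, n)) a x y :
  bilin B (a *: x) y = a * bilin B x y.
Proof. by rewrite /bilin linearZ /= -!scalemxAl mxE. Qed.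

Lemma bilinZr (R : realType) (m n : nat) (B : 'M[R]_(m, n)) a x y :
  bilin B x (a *: y) = a * bilin B x y.
Proof. by rewrite /bilin -!scalemxAr mxE. Qed.

Lemma bilinB (R : realType) (m n : nat) (A B : 'M[R]_(m, n)) x y :
  bilin (A - B) x y = bilin A x y - bilin B x y.
Proof. by rewrite /bilin mulmxBr mulmxBl !mxE. Qed.

Lemma bilin_scalar (R : realType) (n : nat) a (x y : 'cV[R]_n) :
  bilin a%:M x y = a * bilin 1%:M x y.
Proof. by rewrite /bilin -(scalemx1 _ a) -scalemxAr -scalemxAl mxE. Qed.

Lemma bilin_mulmxr (R : realType) (m n p : nat) (A : 'M[R]_(m, n))
    (B : 'M[R]_(n, p)) x y :
  bilin A x (B *m y) = bilin (A *m B) x y.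
Proof. by rewrite /bilin !mulmxA. Qed.

Lemma euclidean_norm_ge0 (R : realType) (n : nat) (x : 'cV[R]_n) :
  0 <= euclidean_norm x.
Proof. exact: sqrtr_ge0. Qed.

Lemma sqr_euclidean_norm (R : realType) (n : nat) (x : 'cV[R]_n) :
  euclidean_norm x ^+ 2 = bilin 1%:M x x.
Proof.
rewrite sqr_sqrtr; last by apply: sumr_ge0 => i _; exact: sqr_ge0.
by rewrite /bilin mulmx1 mxE; apply: eq_bigr => i _; rewrite mxE expr2.
Qed.

Lemma bilin1_ge0 (R : realType) (n : nat) (x : 'cV[R]_n) : 0 <= bilin 1%:M x x.
Proof. by rewrite -sqr_euclidean_norm sqr_ge0. Qed.

Lemma bilin_trmul (R : realType) (m n : nat) (A : 'M[R]_(m, n)) x :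
  bilin (A^T *m A) x x = bilin 1%:M (A *m x) (A *m x).
Proof. by rewrite /bilin mulmx1 trmx_mul !mulmxA. Qed.

Lemma bilin1_eq0 (R : realType) (n : nat) (x : 'cV[R]_n) :
  (bilin 1%:M x x == 0) = (x == 0).
Proof.
rewrite -sqr_euclidean_norm sqr_sqrtr; last first.
  by apply: sumr_ge0 => i _; exact: sqr_ge0.
rewrite psumr_eq0; last by move=> i _; exact: sqr_ge0.
apply/allP/eqP => [x0|-> i _]; last by rewrite mxE expr0n eqxx.
apply/matrixP => i j; rewrite ord1 mxE; apply/eqP.
by rewrite -sqrf_eq0; apply: x0; rewrite mem_index_enum.
Qed.

Lemma psd_cauchy_schwarz (R : realType) (n : nat) (B : 'M[R]_n) x y :
  B^T = B -> (forall z, 0 <= bilin B z z) ->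
  bilin B x y ^+ 2 <= bilin B x x * bilin B y y.
Proof.
move=> Bsym Bpsd.
have yx : bilin B y x = bilin B x y by rewrite -bilin_tr Bsym.
have q a b : 0 <= a ^+ 2 * bilin B x x + 2 * a * b * bilin B x y
                  + b ^+ 2 * bilin B y y.
  have := Bpsd (a *: x + b *: y).
  rewrite !(bilinDl, bilinDr, bilinZl, bilinZr) yx.
  by congr (0 <= _); ring.
have := Bpsd y; rewrite le_eqVlt => /orP[/eqP y0|y0].
  (* With [bilin B y y = 0] these coefficients turn [q] into [0 <= - c ^+ 2 * (2 + a)], which forces
     [c = 0]. *)
  rewrite -y0 mulr0; have := q (- bilin B x y) (1 + bilin B x x).
  rewrite -y0; have := sqr_ge0 (bilin B x y); have := Bpsd x.
  set a := bilin B x x; set c := bilin B x y; nra.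
rewrite -(ler_pM2l y0) -subr_ge0.
(* Up to the factor [bilin B y y], these coefficients minimize the quadratic in [q], whose value
   there is [bilin B y y] times the discriminant gap. *)
have := q (bilin B y y) (- bilin B x y).
by congr (0 <= _); ring.
Qed.

Lemma cauchy_schwarz (R : realType) (n : nat) (x y : 'cV[R]_n) :
  bilin 1%:M x y <= euclidean_norm x * euclidean_norm y.
Proof.
apply: le_trans (ler_norm _) _.
rewrite -ler_sqr ?nnegrE ?normr_ge0 ?mulr_ge0 ?euclidean_norm_ge0//.
rewrite exprMn !sqr_euclidean_norm real_normK ?num_real//.
by apply: psd_cauchy_schwarz; [rewrite trmx1|exact: bilin1_ge0].
Qed.

(** * The largest singular value as operator norm *)

(** Cauchy-Schwarz on each row gives the squared Frobenius norm as a bound; adding 1 keeps [C]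
    positive even for [A = 0]. *)
Lemma euclidean_norm_mulmx_bounded (R : realType) (m n : nat)
    (A : 'M[R]_(m, n)) :
  exists2 C, 0 < C &
    forall x, bilin 1%:M (A *m x) (A *m x) <= C * bilin 1%:M x x.
Proof.
exists (1 + \sum_i bilin 1%:M (row i A)^T (row i A)^T).
  by rewrite ltr_pwDl// sumr_ge0// => i _; exact: bilin1_ge0.
move=> x; rewrite mulrDl mul1r mulr_suml -{1}sqr_euclidean_norm.
rewrite sqr_sqrtr; last first.
  by apply: sumr_ge0 => i _; exact: sqr_ge0.
apply: ler_wpDl; first exact: bilin1_ge0.
apply: ler_sum => i _.
have -> : (A *m x) i 0 = bilin 1%:M (row i A)^T x.
  by rewrite /bilin trmxK mulmx1 -row_mul [RHS]mxE.
by apply: psd_cauchy_schwarz; [rewrite trmx1|exact: bilin1_ge0].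
Qed.

(** No diagonalization is involved: boundedness of [invmx B] gives |x|^2 <= D |B x|^2, and
    semidefiniteness gives |B x|^2 <= (1 + C) x^T B x. *)
Lemma psd_unitmx_coercive (R : realType) (n : nat) (B : 'M[R]_n) :
  B^T = B -> (forall z, 0 <= bilin B z z) -> B \in unitmx ->
  exists2 c, 0 < c & forall x, c * bilin 1%:M x x <= bilin B x x.
Proof.
move=> Bsym Bpsd Bu.
have [C C0 CB] := euclidean_norm_mulmx_bounded B.
have [D D0 DB] := euclidean_norm_mulmx_bounded (invmx B).
exists ((1 + C) * D)^-1; first by rewrite invr_gt0 mulr_gt0// addr_gt0.
move=> x; rewrite ler_pdivrMl ?mulr_gt0 ?addr_gt0//.
have := DB (B *m x); rewrite mulmxA mulVmx// mul1mx => /le_trans; apply.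
rewrite [(1 + C) * D]mulrC -mulrA ler_pM2l//.
(* Cauchy-Schwarz for [B] at [y = B x] and [x], where [y^T B x = |y|^2] *)
set y := B *m x; have := psd_cauchy_schwarz y x Bsym Bpsd.
have -> : bilin B y x = bilin 1%:M y y by rewrite bilin_mulmxr mul1mx.
have := CB y; have := Bpsd y; have := Bpsd x.
have := psd_cauchy_schwarz y (B *m y) (trmx1 _ _) (@bilin1_ge0 R n).
rewrite (bilin_mulmxr 1%:M B) mul1mx; have := bilin1_ge0 y.
set s := bilin 1%:M y y; set t := bilin B y y; set r := bilin B x x.
set q := bilin 1%:M _ _ => s0 tq r0 t0 qs st.
(* Here t^2 <= s q <= C s^2, and C <= (1 + C)^2 avoids taking the square root of [C]. *)
have tC : t <= (1 + C) * s.
  rewrite -ler_sqr ?nnegrE// ?mulr_ge0// ?addr_ge0// ?(ltW C0)//.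
  apply: le_trans tq _; apply: le_trans (ler_wpM2l s0 qs) _.
  have := sqr_ge0 s; nra.
move: s0; rewrite le_eqVlt => /orP[/eqP <-|s0].
  by rewrite mulr_ge0// addr_ge0// ltW.
rewrite -(ler_pM2l s0) -expr2; apply: le_trans st _.
by rewrite mulrA [s * _]mulrC ler_wpM2r.
Qed.

Lemma eigenvalue_unitmx (F : fieldType) (n : nat) (A : 'M[F]_n) a :
  ~~ eigenvalue A a -> a%:M - A \in unitmx.
Proof.
rewrite /eigenvalue /eigenspace negbK kermx_eq0 row_free_unit => Au.
by rewrite -opprB -scaleN1r unitmxZ ?unitrN1.
Qed.

(* The squared operator norm [M] is an eigenvalue of [A^T A]: otherwise
   [M - A^T A], positive semidefinite and invertible, would be coercive, and the
   supremum [M] of [|A x|^2] over the unit sphere could be lowered. *)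
Lemma operator_norm_eigenvalue (R : realType) (n : nat) (A : 'M[R]_n) :
  (0 < n)%N -> exists M, [/\ 0 <= M, eigenvalue (A^T *m A) M &
    forall x, bilin 1%:M (A *m x) (A *m x) <= M * bilin 1%:M x x].
Proof.
move=> n0; pose E := [set bilin 1%:M (A *m x) (A *m x) |
  x in [set x : 'cV[R]_n | bilin 1%:M x x = 1]].
have [C C0 CA] := euclidean_norm_mulmx_bounded A.
have Eub : has_ubound E.
  by exists C => _ [x /= x1 <-]; apply: le_trans (CA x) _; rewrite x1 mulr1.
have E0 : E !=set0.
  pose e : 'cV[R]_n := delta_mx (Ordinal n0) 0.
  exists (bilin 1%:M (A *m e) (A *m e)), e => //=.
  by rewrite /bilin mulmx1 trmx_delta mul_delta_mx mxE !eqxx.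
(* By homogeneity the bound on the unit sphere extends to every vector. *)
have supP x : bilin 1%:M (A *m x) (A *m x) <= sup E * bilin 1%:M x x.
  have [->|x0] := eqVneq x 0.
    by rewrite mulmx0 /bilin !mulmx0 mxE mulr0.
  have {}x0 : 0 < bilin 1%:M x x.
    by rewrite lt_neqAle bilin1_ge0 eq_sym bilin1_eq0 x0.
  pose a := (euclidean_norm x)^-1.
  have a2 : a ^+ 2 * bilin 1%:M x x = 1.
    by rewrite exprVn sqr_euclidean_norm mulVf// gt_eqF.
  have : a ^+ 2 * bilin 1%:M (A *m x) (A *m x) <= sup E.
    apply: ub_le_sup => //; exists (a *: x) => /=.
      by rewrite bilinZl bilinZr mulrA.
    by rewrite -scalemxAr bilinZl bilinZr mulrA.
  by rewrite exprVn sqr_euclidean_norm ler_pdivrMl// mulrC.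
exists (sup E); split => //.
  have [_ [x /= x1 _]] := E0; have := supP x; rewrite x1 mulr1.
  exact/le_trans/bilin1_ge0.
apply: contraT => /eigenvalue_unitmx Bu.
have Bpsd x : 0 <= bilin ((sup E)%:M - A^T *m A) x x.
  by rewrite bilinB bilin_scalar bilin_trmul subr_ge0.
have Bsym : ((sup E)%:M - A^T *m A)^T = (sup E)%:M - A^T *m A.
  by rewrite linearB /= tr_scalar_mx trmx_mul trmxK.
have [c c0 Bc] := psd_unitmx_coercive Bsym Bpsd Bu.
have : sup E <= sup E - c.
  apply: ge_sup => // _ [x /= x1 <-].
  by have := Bc x; rewrite bilinB bilin_scalar bilin_trmul x1 !mulr1; lra.
lra.
Qed.

Lemma euclidean_norm_mulmx (R : realType) (n : nat) (A : 'M[R]_n) x :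
  euclidean_norm (A *m x) <= largest_singular_value A * euclidean_norm x.
Proof.
case: n A x => [|n] A x.
  by rewrite /euclidean_norm !big_ord0 sqrtr0 mulr0.
have [M [M0 MA AM]] := operator_norm_eigenvalue A (ltn0Sn n).
(* The supremum is meaningful only on a bounded set. The square of a singular value is the Rayleigh
   quotient of an eigenvector, hence at most [M]. Eigenvectors are rows here, so [u] is
   transposed. *)
have bounded : has_ubound [set s | singular_value A s].
  exists (Num.sqrt M) => s /= [s0 /eigenvalueP[u us u0]].
  rewrite -ler_sqr ?nnegrE ?sqrtr_ge0// sqr_sqrtr//.
  have ut0 : 0 < bilin 1%:M u^T u^T.
    by rewrite lt_neqAle bilin1_ge0 eq_sym bilin1_eq0 trmx_eq0 u0.
  have := AM u^T; rewrite -bilin_trmul.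
  have -> : bilin (A^T *m A) u^T u^T = s ^+ 2 * bilin 1%:M u^T u^T.
    by rewrite /bilin trmxK us mulmx1 -scalemxAl mxE.
  by rewrite ler_pM2r.
have : Num.sqrt M <= largest_singular_value A.
  apply: ub_le_sup => //=; split; first exact: sqrtr_ge0.
  by rewrite sqr_sqrtr.
move=> /(ler_wpM2r (euclidean_norm_ge0 x)); apply: le_trans.
rewrite -ler_sqr ?nnegrE ?mulr_ge0 ?sqrtr_ge0//.
by rewrite exprMn (sqr_sqrtr M0) !sqr_euclidean_norm.
Qed.

(** * Norm inequalities and bounds on matrix entries *)

Lemma euclidean_normZ (R : realType) (n : nat) a (x : 'cV[R]_n) :
  euclidean_norm (a *: x) = `|a| * euclidean_norm x.
Proof.
apply/eqP; rewrite -(@eqrXn2 _ 2) ?mulr_ge0 ?euclidean_norm_ge0// exprMn.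
by rewrite real_normK ?num_real// !sqr_euclidean_norm bilinZl bilinZr mulrA.
Qed.

Lemma ler_euclidean_normD (R : realType) (n : nat) (x y : 'cV[R]_n) :
  euclidean_norm (x + y) <= euclidean_norm x + euclidean_norm y.
Proof.
rewrite -ler_sqr ?nnegrE ?addr_ge0 ?euclidean_norm_ge0//.
have := cauchy_schwarz x y.
rewrite sqrrD !sqr_euclidean_norm !(bilinDl, bilinDr) -(bilin_tr _ y x) trmx1.
lra.
Qed.

Lemma euclidean_norm_const1 (R : realType) (n : nat) :
  euclidean_norm (const_mx 1 : 'cV[R]_n) = Num.sqrt n%:R.
Proof.
congr Num.sqrt; rewrite -[RHS]mulr1 -[n in RHS]card_ord mulr_natl -sumr_const.
by apply: eq_bigr => i _; rewrite mxE expr1n.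
Qed.

Lemma ler_norm_entry (R : realType) (n : nat) (x : 'cV[R]_n) i :
  `|x i 0| <= euclidean_norm x.
Proof.
rewrite -sqrtr_sqr ler_wsqrtr// (bigD1 i)//= lerDl.
by apply: sumr_ge0 => j _; exact: sqr_ge0.
Qed.

(** An entry is a coordinate of the image of a unit basis vector. This makes entries of a random
    matrix with a spectral bound integrable. *)
Lemma ler_norm_mx_entry (R : realType) (n : nat) (A : 'M[R]_n) i j :
  `|A i j| <= largest_singular_value A.
Proof.
have -> : A i j = (A *m delta_mx j 0 : 'cV_n) i 0 by rewrite -colE mxE.
apply: le_trans (ler_norm_entry _ _) _.
apply: le_trans (euclidean_norm_mulmx _ _) _.
rewrite [X in _ * X](_ : _ = 1) ?mulr1// -[RHS]sqrtr1; congr Num.sqrt.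
rewrite (bigD1 j)//= mxE !eqxx expr1n big1 ?addr0// => k kj.
by rewrite mxE (negPf kj) expr0n.
Qed.

Lemma largest_singular_value_ge0 (R : realType) (n : nat) (A : 'M[R]_n) :
  (0 < n)%N -> 0 <= largest_singular_value A.
Proof.
move=> n0; exact: le_trans (ler_norm_mx_entry A (Ordinal n0) (Ordinal n0)).
Qed.

(** * Expectations of random matrices *)

Lemma probability_nonempty (d : measure_display) (T : measurableType d)
    (R : realType) (P : probability T R) : [set: T] !=set0.
Proof.
apply/set0P/eqP => T0; have := probability_setT P.
by rewrite T0 measure0 => /eqP; rewrite eq_sym onee_eq0.
Qed.

Section expectation_mx_bound.
Context (d : measure_display) (T : measurableType d) (R : realType).
Variable P : probability T R.

Lemma Rintegral_sum (I : Type) (s : seq I) (f : I -> T -> R) :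
  (forall i, P.-integrable setT (EFin \o f i)) ->
  Rintegral P setT (fun w => \sum_(i <- s) f i w) =
  \sum_(i <- s) Rintegral P setT (f i).
Proof.
move=> fint; elim: s => [|i s IHs].
  rewrite big_nil -[RHS](mul0r (fine (P setT))) -Rintegral_cst//.
  by apply: eq_Rintegral => w _; rewrite big_nil.
rewrite big_cons -IHs -RintegralD//.
  by apply: eq_Rintegral => w _; rewrite big_cons.
rewrite (_ : _ \o _ = fun w => (\sum_(j <- s) (f j w)%:E)%E).
  by apply: integrable_sum => // j _; exact: fint.
by apply/funext => w /=; rewrite sumEFin.
Qed.

Variables (n : nat) (A : T -> 'M[R]_n) (g : R).
Hypothesis A_measurable : forall i j, measurable_fun setT (fun w => A w i j).
Hypothesis A_le : forall w, largest_singular_value (A w) <= g.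

Lemma integrable_mx_entry i j :
  P.-integrable setT (EFin \o (fun w => A w i j)).
Proof.
apply: measurable_bounded_integrable => //=.
  by rewrite probability_setT ltry.
exists g; split; first exact: num_real.
move=> M gM w _ /=; apply: le_trans (ltW gM).
exact: le_trans (ler_norm_mx_entry _ _ _) (A_le w).
Qed.

Lemma integrable_entry_term (x y : 'cV[R]_n) i j :
  P.-integrable setT (EFin \o (fun w => x i 0 * A w i j * y j 0)).
Proof.
rewrite (_ : _ \o _ =
  fun w => ((x i 0 * y j 0)%:E * (EFin \o (fun w => A w i j)) w)%E).
  by apply: integrableZl => //; exact: integrable_mx_entry.
by apply/funext => w /=; rewrite -EFinM mulrAC.
Qed.

Lemma integrable_bilin (x y : 'cV[R]_n) :
  P.-integrable setT (EFin \o (fun w => bilin (A w) x y)).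
Proof.
rewrite (_ : _ \o _ =
  fun w => (\sum_i \sum_j (x i 0 * A w i j * y j 0)%:E)%E).
  apply: integrable_sum => // i _; apply: integrable_sum => // j _.
  exact: integrable_entry_term.
apply/funext => w /=; rewrite bilinE -sumEFin.
by apply: eq_bigr => i _; rewrite sumEFin.
Qed.

Lemma bilin_expectation_mx (x y : 'cV[R]_n) :
  bilin (expectation_mx P A) x y = Rintegral P setT (fun w => bilin (A w) x y).
Proof.
under [RHS]eq_Rintegral do rewrite bilinE.
rewrite Rintegral_sum => [|i].
  rewrite bilinE; apply: eq_bigr => i _; rewrite Rintegral_sum => [|j].
    apply: eq_bigr => j _; rewrite !mxE unlock mulrAC.
    (* Once the expectation is unlocked, its finite part is a real integral by conversion. *)
    rewrite -[fine _]/(Rintegral P setT (fun w => A w i j)).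
    rewrite -RintegralZl//; last exact: integrable_mx_entry.
    by apply: eq_Rintegral => w _; rewrite mulrAC.
  exact: integrable_entry_term.
rewrite (_ : _ \o _ = fun w => (\sum_j (x i 0 * A w i j * y j 0)%:E)%E).
  by apply: integrable_sum => // j _; exact: integrable_entry_term.
by apply/funext => w /=; rewrite sumEFin.
Qed.

(* With [y = E[A] x], [|y|^2 = E[y^T A x] <= |y| g |x|]. *)
Lemma euclidean_norm_expectation_mulmx (x : 'cV[R]_n) :
  euclidean_norm (expectation_mx P A *m x) <= g * euclidean_norm x.
Proof.
set y := _ *m x.
(* Division by |y| is impossible here. What remains, 0 <= g |x|, follows from the spectral bound at
   any sample point. *)
have [y0|y0] := eqVneq (euclidean_norm y) 0.
  have [w _] := probability_nonempty P.
  rewrite y0; apply: le_trans (_ : 0 <= euclidean_norm (A w *m x)) _.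
    exact: euclidean_norm_ge0.
  apply: le_trans (euclidean_norm_mulmx _ _) _.
  by rewrite ler_wpM2r ?euclidean_norm_ge0.
have {}y0 : 0 < euclidean_norm y.
  by rewrite lt_neqAle eq_sym y0 euclidean_norm_ge0.
rewrite -(ler_pM2l y0) -expr2 sqr_euclidean_norm {2}/y bilin_mulmxr mul1mx.
rewrite bilin_expectation_mx.
apply: le_trans (_ : _ <= Rintegral P setT
  (cst (euclidean_norm y * (g * euclidean_norm x)))) _.
  apply: le_Rintegral => //.
  - exact: integrable_bilin.
  - exact: finite_measure_integrable_cst.
  - move=> w _; rewrite -[A w]mul1mx -bilin_mulmxr.
    apply: le_trans (cauchy_schwarz _ _) _.
    rewrite ler_pM2l//; apply: le_trans (euclidean_norm_mulmx _ _) _.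
    by rewrite ler_wpM2r ?euclidean_norm_ge0.
rewrite Rintegral_cst//.
by have /(congr1 fine) /= -> := probability_setT P; rewrite mulr1.
Qed.

End expectation_mx_bound.

(** * Affine contraction and conclusion *)

(** The sequence [b] solves the recursion with equality from the same initial value, dominates [a],
    and tends to the fixed point [L]. Since [a] itself need not converge, the bound is on its limit
    superior. *)
Lemma limn_esup_affine_le (R : realType) (a : nat -> R) (g c : R) :
  0 <= g < 1 -> (forall t, a t.+1 <= g * a t + c) ->
  (limn_esup (EFin \o a) <= (c / (1 - g))%:E)%E.
Proof.
move=> /andP[g0 g1] aS; pose L := c / (1 - g).
have cE : c = (1 - g) * L by rewrite mulrC divfK// subr_eq0 gt_eqF.
pose b t := geometric (a 0%N - L) g t + L.
have ab t : a t <= b t.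
  elim: t => [|t IHt]; first by rewrite /b /= expr0 mulr1 subrK.
  have -> : b t.+1 = g * b t + c by rewrite cE /b /= exprS; ring.
  by apply: le_trans (aS t) _; rewrite lerD2r ler_wpM2l.
have bL : (EFin \o b) @ \oo --> L%:E.
  apply: cvg_EFin; first by near=> t.
  rewrite -[X in _ --> X]add0r; apply: cvgD; last exact: cvg_cst.
  by apply: cvg_geometric; rewrite ger0_norm.
(* Convergence of [b] identifies [L] with its limit superior, so it suffices to compare the tail
   suprema of [a] and [b]. *)
rewrite -/L -(cvg_limn_einf_sup bL).2 !limn_esup_lim.
apply: lee_lim; [exact: is_cvg_esups|exact: is_cvg_esups|].
near=> n; apply: ub_ereal_sup => _ [t /= nt <-].
apply: le_trans (_ : ((b t)%:E <= _)%E); first by rewrite lee_fin.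
by apply: ereal_sup_ubound; exists t.
Unshelve. all: by end_near. Qed.

Theorem proposition3p1 (R : realType) (N : nat) (N_gt1 : (1 < N)%N)
  (d1 d2 : measure_display) (T : measurableType d1) (T' : measurableType d2)
  (Pphi : probability T R) (Pv : probability T' R)
  (d : nat -> R)
  (sigma : R) (sigma_gt0 : 0 < sigma)
  (v : nat -> 'I_N -> {RV Pv >-> R})
  (v_normal : forall t i, distribution Pv (v t i) = normal_prob 0 sigma
                            :> (set R -> \bar R))
  (v_uncorrelated : forall t i j, i != j -> covariance Pv (v t i) (v t j) = 0%E)
  (p : nat -> 'I_N -> 'I_N -> R)
  (p01 : forall t i j, 0 <= p t i j <= 1)
  (phi : nat -> 'I_N -> 'I_N -> {RV Pphi >-> bool})
  (phi_bernoulli : forall t i j, i != j ->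
     distribution Pphi (phi t i j) = bernoulli_prob (p t i j)
       :> (set bool -> \bar R))
  (phi_diag : forall t i w, phi t i i w = true)
  (phi_independent : mutually_independent Pphi
     [set l : nat * 'I_N * 'I_N | l.1.2 != l.2]
     (fun l => phi l.1.1 l.1.2 l.2))
  (K H : nat -> T -> 'M[R]_N)
  (K_measurable : forall t i j, measurable_fun setT (fun w => K t w i j))
  (H_measurable : forall t i j, measurable_fun setT (fun w => H t w i j))
  (weights : forall t i w,
     \sum_j K t w i j * (phi t i j w)%:R +
     \sum_j H t w i j * (phi t i j w)%:R = 1)
  (gamma_max Delta : R)
  (system : forall t, (0 < t)%N ->
     expected_error Pphi Pv d v phi K H t =
       expectation_mx Pphi
         (fun w => hadamard (K t w) (packet_mx R phi t w)) *m
         expected_error Pphi Pv d v phi K H t.-1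
       - delta d t *:
         (expectation_mx Pphi
            (fun w => hadamard (K t w) (packet_mx R phi t w)) *m const_mx 1))
  (gamma_le : forall t w,
     largest_singular_value (hadamard (K t w) (packet_mx R phi t w))
       <= gamma_max)
  (gamma_max_lt1 : gamma_max < 1)
  (delta_lt : forall t, `|delta d t| < Delta) :
  (limn_esup (fun t =>
     (euclidean_norm (expected_error Pphi Pv d v phi K H t))%:E)
   <= (Delta * Num.sqrt N%:R * gamma_max / (1 - gamma_max))%:E)%E.
Proof.
have N0 : (0 < N)%N := ltnW N_gt1.
have [w0 _] := probability_nonempty Pphi.
(* Nonnegativity of [gamma_max] comes from a singular value at a sample point. *)
have g0 : 0 <= gamma_max.
  exact: le_trans (largest_singular_value_ge0 _ N0) (gamma_le 0 w0).
apply: (@limn_esup_affine_le R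
  (fun t => euclidean_norm (expected_error Pphi Pv d v phi K H t))).
  by rewrite g0.
move=> t; rewrite system//= scalemxAr -mulmxBr.
apply: le_trans.
  apply: (@euclidean_norm_expectation_mulmx _ _ _ _ _ _ gamma_max) => // i j.
  (* Writing the packet variable as the indicator of an event makes the entry a product of
     measurable functions. *)
  have -> : (fun w => hadamard (K t.+1 w) (packet_mx R phi t.+1 w) i j) =
            (fun w => K t.+1 w i j * \1_(phi t.+1 i j @^-1` [set true]) w).
    apply/funext => w; rewrite !mxE indicE; congr (_ * (nat_of_bool _)%:R).
    by apply/idP/idP; rewrite inE.
  apply: measurable_funM; first exact: K_measurable.
  apply: measurable_indic.
  by rewrite -[X in measurable X]setTI; exact: measurable_funP.
rewrite [leRHS](_ : _ = gamma_max * (euclidean_norm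
  (expected_error Pphi Pv d v phi K H t) + Delta * Num.sqrt N%:R)); last by ring.
rewrite ler_wpM2l//; apply: le_trans (ler_euclidean_normD _ _) _.
rewrite lerD2l -scaleNr euclidean_normZ normrN euclidean_norm_const1.
by rewrite ler_wpM2r ?sqrtr_ge0// ltW.
Qed.
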